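(* For any flag simplicial complex $K$ on $[m]$, each connected component of the configuration space $C_K$ is contractible.
   Context: $[m]=\{1,\dots,m\}$; $\mathbb{N}$ denotes the non-negative integers. A simplicial complex $K$ on $[m]$ is a collection of subsets of $[m]$ containing $\emptyset$ and closed under taking subsets. A missing face of $K$ is a subset $\tau\subset[m]$ with $\tau\notin K$ all of whose proper subsets are in $K$; $K$ is flag if every missing face has exactly 2 elements. Let $B(k)$ be the space of $k$-element subsets $\{t(1)<\dots<t(k)\}$ of $\mathbb{R}$. For $I=(i_1,\dots,i_m)\in\mathbb{N}^m$ the space $C_K(I)\subset B(i_1)\times\dots\times B(i_m)$ consists of all $(\mathbf{t}_1,\dots,\mathbf{t}_m)$ with $\bigcap_{j\in\tau}\mathbf{t}_j=\emptyset$ for each $\tau\notin K$; $C_K=\bigsqcup_{I\in\mathbb{N}^m}C_K(I)$. *)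

(* Defs.v *)
From HB Require Import structures.
From mathcomp Require Import all_boot all_order all_algebra.
From mathcomp Require Import all_classical all_reals all_analysis.

Set Implicit Arguments.
Unset Strict Implicit.
Unset Printing Implicit Defensive.

Import Order.TTheory GRing.Theory Num.Theory.
Import numFieldNormedType.Exports.

Local Open Scope classical_set_scope.
Local Open Scope ring_scope.

(* 'I_m plays the role of the vertex set [m]; a vertex of 'I_m need not be a
   face of the complex. *)
Record simplicial_complex (m : nat) := SimplicialComplex {
  faces :> {set {set 'I_m}};
  faces0 : finset.set0 \in faces;
  faces_closed : forall s t : {set 'I_m},
    t \in faces -> s \subset t -> s \in faces }.

Definition missing_face (m : nat) (K : simplicial_complex m)
    (tau : {set 'I_m}) : Prop :=
  tau \notin K /\ forall s : {set 'I_m}, s \proper tau -> s \in K.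

Definition flag_complex (m : nat) (K : simplicial_complex m) : Prop :=
  forall tau : {set 'I_m}, missing_face K tau -> #|tau| = 2%N.

(* A k-element subset {t(1) < ... < t(k)} of R is represented by the row vector
   of its elements listed in increasing order: B(k) is a subspace of R^k. *)
Definition increasing_rows (R : realType) (k : nat) : set 'rV[R]_k :=
  [set t | forall i j : 'I_k, (i < j)%N -> t ord0 i < t ord0 j].

Definition B (R : realType) (k : nat) : topologicalType :=
  set_type (@increasing_rows R k).

Definition points (R : realType) (k : nat) (t : B R k) : set R :=
  range (fun i : 'I_k => (\val t : 'rV[R]_k) ord0 i).

Definition multi_index (m : nat) := {ffun 'I_m -> nat}.

Definition conf_set (R : realType) (m : nat) (K : simplicial_complex m)
    (I : multi_index m) : set (prod_topology (fun j : 'I_m => B R (I j))) :=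
  [set t | forall tau : {set 'I_m}, tau \notin K ->
     \bigcap_(j in [set` tau]) points (t j) = set0].

Definition conf_piece (R : realType) (m : nat) (K : simplicial_complex m)
    (I : multi_index m) : topologicalType :=
  set_type (@conf_set R m K I).

(* The sigma type carries the disjoint union topology. *)
Definition conf_space (R : realType) (m : nat) (K : simplicial_complex m) :
    topologicalType :=
  {I : multi_index m & conf_piece R K I}.

(* The identity of X is homotopic to a constant map; in particular X is not
   empty. Only the values h (x, s) with 0 <= s <= 1 matter. *)
Definition contractible (R : realType) (X : topologicalType) : Prop :=
  exists (x0 : X) (h : X * R -> X),
    [/\ {within [set: X] `*` `[0, 1]%classic, continuous h},
        forall x, h (x, 0) = x & forall x, h (x, 1) = x0].

(* Main.v *)
Require Import Defs.
From mathcomp Require Import all_boot all_order all_algebra.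
From mathcomp Require Import all_classical all_reals all_analysis.
From mathcomp Require Import lra.

(** When [K] is flag, membership in [C_K(I)] only constrains pairs: the points
of [t_j] and [t_k] must be distinct whenever [{j, k}] is not a face. The
relative order of such points is locally constant, and the configurations with
a prescribed relative order form a convex set, so these convex sets are the
connected components, and each contracts along straight lines. *)

Local Open Scope classical_set_scope.

Import Order.TTheory GRing.Theory Num.Theory.
Import numFieldNormedType.Exports.

Local Open Scope ring_scope.

(** * Clopen sets, disjoint unions and continuity into subspaces and products *)

(** The trace of [U] on the component of [x] contains [x] and is open and closed there, so
    connectedness makes it the whole component. *)
Lemma clopen_connected_component (T : topologicalType) (x : T) (U : set T) :
  clopen U -> U x -> connected_component setT x `<=` U.
Proof.
move=> [oU cU] Ux y Cy.
have /(_ (connected_component setT x `&` U)) CE :=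
  @component_connected T setT x.
suff: (connected_component setT x `&` U) y by case.
rewrite CE//.
- by exists x; split=> //; exact: connected_component_refl.
- by exists U.
- by exists U.
Qed.

(** As [f] never vanishes, [0 < f] and [0 <= f] cut out the same set; the first form is open, the
    second closed. *)
Lemma gt0_clopen (R : realType) (T : topologicalType) (f : T -> R) :
  continuous f -> (forall x, f x != 0) -> clopen [set x | 0 < f x].
Proof.
move=> cf f0; split.
  by apply: (@open_comp _ _ f [set r | 0 < r]) => [x _|]; [exact: cf|exact: open_gt].
rewrite (_ : [set x | _] = f @^-1` [set r | 0 <= r]).
  by apply: closed_comp => [x _|]; [exact: cf|exact: closed_ge].
by apply/seteqP; split=> x /=; rewrite lt_neqAle eq_sym f0.
Qed.

Lemma tag_clopen (I : choiceType) (T : I -> topologicalType) (i : I) :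
  clopen [set y : {i & T i} | tag y = i].
Proof.
(* Any condition on the tag alone restricts to all or nothing on each summand. *)
have oP (P : set I) : open [set y : {i & T i} | P (tag y)].
  apply/sigT_openP => j; have [Pj|nPj] := pselect (P j).
    by rewrite (_ : _ @^-1` _ = setT) ?predeqE//; exact: openT.
  by rewrite (_ : _ @^-1` _ = set0) ?predeqE//; exact: open0.
split; first exact: (oP [set j | j = i]).
by rewrite -openC; exact: (oP [set j | j <> i]).
Qed.

(** The map is the identity on the summand [i] and constant on the others. This retraction lets
    functions on one summand be extended to the whole disjoint union. *)
Lemma untag_id_continuous (I : choiceType) (T : I -> topologicalType) (i : I)
    (t : T i) :
  continuous (untag t id : {i & T i} -> T i).
Proof.
move=> [j y]; suff /(_ y) : continuous (fun z : T j => untag t id (existT T j z)).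
  by move=> cj U nU; apply: existT_continuous; exact: cj.
have [ij|nij] := eqVneq j i.
  move: t; rewrite -{}ij => t z.
  by rewrite (_ : (fun _ => _) = id)//; apply/funext => w; rewrite untagE.
rewrite (_ : (fun _ => _) = cst t); first exact: cst_continuous.
by apply/funext => z; rewrite untag_dflt.
Qed.

(** A matrix has finitely many entries, so the neighborhoods obtained entry by entry can be
    intersected. *)
Lemma mx_continuous (X T : topologicalType) (m n : nat)
    (f : X -> 'M[T]_(m, n)) :
  (forall i j, continuous (fun x => f x i j)) -> continuous f.
Proof.
move=> cf x A [P nP sPA].
have : \forall y \near x, forall i, forall j, P i j (f y i j).
  by apply: filter_forall => i; apply: filter_forall => j; exact: cf.
by apply: filterS => y; exact: sPA.
Qed.

Lemma set_type_continuous (X Y : topologicalType) (A : set Y)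
    (f : X -> set_type A) :
  continuous (fun x => \val (f x)) -> continuous f.
Proof. exact: (@continuous_comp_initial _ _ _ (set_val : set_type A -> Y)). Qed.

Lemma prod_topology_continuous (J : Type) (T : J -> topologicalType)
    (X : topologicalType) (f : X -> prod_topology T) :
  (forall j, continuous (fun x => f x j)) -> continuous f.
Proof.
move=> cf x; apply/cvg_sup => j.
exact: (@continuous_comp_initial _ _ _ (fun g : prod_topology T => g j)).
Qed.

Lemma set_val_continuous (Y : topologicalType) (A : set Y) :
  continuous (fun x : set_type A => \val x).
Proof. exact: (@initial_continuous _ _ (set_val : set_type A -> Y)). Qed.

(** * Coordinates on a piece $C_K(I)$ and convexity *)

Section Configurations.
Context {R : realType} {m : nat} {K : simplicial_complex m}.
Context {I : multi_index m}.
Implicit Types (s t : conf_piece R K I) (j k : 'I_m).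

Definition coord s j (a : 'I_(I j)) : R := (\val (\val s j) : 'rV[R]_(I j)) ord0 a.

Lemma coord_inj s t : (forall j a, coord s j a = coord t j a) -> s = t.
Proof.
move=> st; apply/val_inj/functional_extensionality_dep => j.
by apply/val_inj/rowP => a; exact: st.
Qed.

Lemma conf_coord_continuous j a : continuous (fun s => coord s j a).
Proof.
move=> s.
apply: (@continuous_comp _ _ _ (fun s => \val (\val s j) : 'rV[R]_(I j))
  (fun v => v ord0 a)); last exact: coord_continuous.
apply: (@continuous_comp _ _ _ (fun s => \val s j)); last exact: set_val_continuous.
apply: (@continuous_comp _ _ _ (fun s => \val s) (@proj _ _ j));
  [exact: set_val_continuous|exact: proj_continuous].
Qed.

Lemma conf_piece_continuous (X : topologicalType) (f : X -> conf_piece R K I) :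
  (forall j a, continuous (fun x => coord (f x) j a)) -> continuous f.
Proof.
move=> cf; apply: set_type_continuous; apply: prod_topology_continuous => j.
apply: set_type_continuous; apply: mx_continuous => i a.
by rewrite (ord1 i); exact: cf.
Qed.

Lemma coord_increasing s j (a b : 'I_(I j)) :
  (a < b)%N -> coord s j a < coord s j b.
Proof. by move=> ab; exact: (set_mem (valP (\val s j))). Qed.

Lemma coord_neq s j k a b : [set j; k]%SET \notin K -> coord s j a != coord s k b.
Proof.
move=> jkK; apply/eqP => e.
have /(_ _ jkK) := set_mem (valP s); rewrite -subset0; apply => l /=.
by rewrite !inE => /orP[] /eqP ->; [exists a|exists b].
Qed.

(** Take a nonface inside [tau] that is minimal for inclusion. *)
Lemma nonface_missing_face (tau : {set 'I_m}) : tau \notin K ->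
  exists2 sigma : {set 'I_m}, sigma \subset tau & missing_face K sigma.
Proof.
move=> tauK; have [sigma sK st] := minset_exists (P := fun s : {set 'I_m} => s \notin K) tauK.
exists sigma => //; split; first exact: minsetp sK.
move=> r /[dup] /proper_sub rs; apply: contraTT => rK.
by rewrite (minsetinf sK rK rs) fintype.properxx.
Qed.

(** Flagness enters here: every nonface contains a missing face, which is a pair, so a point common
    to all sets indexed by the nonface would already violate a pairwise condition. *)
Lemma conf_piece_of_coord (flagK : flag_complex K)
    (c : forall j, 'I_(I j) -> R) :
  (forall j (a b : 'I_(I j)), (a < b)%N -> c j a < c j b) ->
  (forall j k a b, [set j; k]%SET \notin K -> c j a != c k b) ->
  exists s, forall j a, coord s j a = c j a.
Proof.
move=> cincr cneq.
have incr j : (\row_a c j a : 'rV[R]_(I j)) \in @increasing_rows R (I j).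
  by apply/mem_set => a b ab; rewrite !mxE; exact: cincr.
pose t : prod_topology (fun j => B R (I j)) :=
  fun j => exist _ (\row_a c j a) (incr j).
suff tK : t \in @conf_set R m K I.
  by exists (exist _ t tK) => j a; rewrite /coord/= mxE.
apply/mem_set => tau /nonface_missing_face[sigma st sK].
have /eqP/cards2P[j [k [_ sE]]] := flagK _ sK.
rewrite -subset0 => r tr.
have [|a _ ra] := tr j; first by apply/(fintype.subsetP st); rewrite sE !inE eqxx.
have [|b _ rb] := tr k; first by apply/(fintype.subsetP st); rewrite sE !inE eqxx orbT.
rewrite /= mxE in ra; rewrite /= mxE in rb.
have : c j a != c k b by apply: cneq; rewrite -sE; case: sK.
by rewrite ra rb eqxx.
Qed.

(** Only nonfaces are compared: when [j] and [k] are distinct and span a face, their points may pass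
    through each other. *)
Definition same_order s t : Prop := forall j k a b, [set j; k]%SET \notin K ->
  (coord s j a < coord s k b) = (coord t j a < coord t k b).

(** Convex combinations preserve strict inequalities that hold at both ends, here those within a row
    and those between rows [j], [k] spanning a nonface. *)
Lemma conf_piece_segment (flagK : flag_complex K) s t (u : R) :
  same_order s t -> 0 <= u <= 1 ->
  exists r, forall j a, coord r j a = (1 - u) * coord s j a + u * coord t j a.
Proof.
move=> st u01; have convlt (x y x' y' : R) : x < y -> x' < y' ->
  (* At [u = 1] only the second inequality counts; otherwise [1 - u] is positive and the first one
     is already strict. *)
  (1 - u) * x + u * x' < (1 - u) * y + u * y'.
  move=> xy xy'; have [->|u1] := eqVneq u 1; first by lra.
  have : u < 1 by rewrite lt_neqAle u1; lra.
  by move=> ?; nra.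
apply: conf_piece_of_coord => // [j a b ab|j k a b jkK].
  by apply: convlt; exact: coord_increasing.
have [ab|ba|/eqP e] := ltgtP (coord s j a) (coord s k b).
- by rewrite lt_eqF// convlt// -st.
- by rewrite gt_eqF// convlt// -st// finset.setUC.
- by rewrite (negPf (coord_neq s j k a b jkK)) in e.
Qed.

Definition conf_in (s : conf_piece R K I) : conf_space R K :=
  existT (fun J => (conf_piece R K J : Type)) I s.

(** The junk value [t] is returned when [y] does not lie over [I]. *)
Definition conf_out t (y : conf_space R K) : conf_piece R K I :=
  @untag _ (fun J => (conf_piece R K J : Type)) _ t I id y.

Lemma conf_inK t s : conf_out t (conf_in s) = s.
Proof. by rewrite /conf_out untagE. Qed.

Lemma conf_in_continuous : continuous conf_in.
Proof. exact: (@existT_continuous _ (conf_piece R K)). Qed.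

Lemma conf_out_continuous t : continuous (conf_out t).
Proof. exact: (@untag_id_continuous _ (conf_piece R K)). Qed.

End Configurations.

(** * Connected components and their contraction *)

Lemma component_same_order (R : realType) (m : nat) (K : simplicial_complex m)
    (I : multi_index m) (t : conf_piece R K I) (y : conf_space R K) :
  connected_component [set: conf_space R K] (conf_in t) y ->
  conf_in (conf_out t y) = y /\ same_order (conf_out t y) t.
Proof.
move=> Cy; split.
  have := clopen_connected_component _ _ _
    (tag_clopen _ (conf_piece R K) I) (erefl : tag (conf_in t) = I) _ Cy.
  case: y {Cy} => J s /= JI; move: t; rewrite -{}JI => t.
  by rewrite conf_inK.
move=> j k a b jkK.
(* Off the summand [I], [D] takes its value at [t], so it is continuous and nonzero on the whole
   space and its sign is constant on components. *)
pose D (z : conf_space R K) :=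
  coord (conf_out t z) k b - coord (conf_out t z) j a.
have co l c : continuous (fun z : conf_space R K => coord (conf_out t z) l c).
  move=> z; apply: (@continuous_comp _ _ _ (conf_out t) (fun s => coord s l c)).
    exact: conf_out_continuous.
  exact: conf_coord_continuous.
have cD : continuous D by move=> z; apply: (@continuousB _ R); exact: co.
have D0 z : D z != 0 by rewrite subr_eq0 eq_sym coord_neq.
have tE : conf_out t (conf_in t) = t by rewrite conf_inK.
have [pos|npos] := boolP (coord t j a < coord t k b).
  have := clopen_connected_component _ _ _ (gt0_clopen _ _ D cD D0) _ _ Cy.
  by rewrite /= /D !subr_gt0 tE; apply.
have cND : continuous (fun z => - D z) by move=> z; apply: cvgN; exact: cD.
have ND0 z : - D z != 0 by rewrite oppr_eq0.
have := clopen_connected_component _ _ _ (gt0_clopen _ _ _ cND ND0) _ _ Cy.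
rewrite /= /D tE !opprB !subr_gt0 => h; apply/negbTE; rewrite -leNgt ltW// h//.
by rewrite lt_neqAle leNgt npos andbT eq_sym coord_neq.
Qed.

Theorem lemma5p3 (R : realType) (m : nat) (K : simplicial_complex m)
    (flagK : flag_complex K) (x : conf_space R K) :
  contractible R
    (set_type (connected_component [set: conf_space R K] x)).
Proof.
case: x => I t; rewrite -[existT _ _ _]/(conf_in t); set C := connected_component _ _.
(* The homotopy must be a function on all of [R], but segments stay in the configuration space only
   for times in $[0,1]$; clamping the time gives a globally continuous map. *)
pose clamp (u : R) : R := Num.max 0 (Num.min 1 u).
have clamp01 u : 0 <= clamp u <= 1.
  by rewrite /clamp le_max lexx/= ge_max ler01 ge_min lexx.
have cclamp : continuous clamp.
  move=> u; apply: (@continuous_max R R); first exact: cst_continuous.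
  by apply: (@continuous_min R R); [exact: cst_continuous|exact: cvg_id].
have L0 (p : set_type C * R) : exists r : conf_piece R K I, forall j a,
    coord r j a = (1 - clamp p.2) * coord (conf_out t (\val p.1)) j a +
                  clamp p.2 * coord t j a.
  apply: conf_piece_segment => //.
  by case: (component_same_order _ _ _ _ _ _ (set_mem (valP p.1))).
have [L LE] := choice L0.
have cL : continuous L.
  apply: conf_piece_continuous => j a p.
  under eq_fun do rewrite LE.
  have cc : {for p, continuous (fun q : set_type C * R => clamp q.2)}.
    by apply: (@continuous_comp _ _ _ snd clamp); [exact: cvg_snd|exact: cclamp].
  apply: cvgD; apply: cvgM.
  - by apply: cvgB; [exact: cst_continuous|exact: cc].
  - apply: (@continuous_comp _ _ _ (fun q : set_type C * R => conf_out t (\val q.1))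
      (fun s => coord s j a)); last exact: conf_coord_continuous.
    apply: (@continuous_comp _ _ _ (fun q : set_type C * R => \val q.1));
      last exact: conf_out_continuous.
    by apply: (@continuous_comp _ _ _ fst); [exact: cvg_fst|exact: set_val_continuous].
  - exact: cc.
  - exact: cst_continuous.
have clamp0 : clamp 0 = 0 by rewrite /clamp (min_idPr ler01) maxxx.
have clamp1 : clamp 1 = 1 by rewrite /clamp minxx (max_idPr ler01).
have L0E y : conf_in (L (y, 0)) = \val y.
  have [<- _] := component_same_order _ _ _ _ _ _ (set_mem (valP y)).
  congr conf_in; apply: coord_inj => j a.
  by rewrite LE/= clamp0 subr0 mul1r mul0r addr0.
have L1E y : L (y, 1) = t.
  by apply: coord_inj => j a; rewrite LE/= clamp1 subrr mul0r add0r mul1r.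
pose path p : conf_space R K := conf_in (L p).
have cpath : continuous path.
  move=> p; apply: (@continuous_comp _ _ _ L conf_in); first exact: cL.
  exact: conf_in_continuous.
(* The image of the connected line [R] under [v] $\mapsto$ [path (y, v)] is connected and contains
   [conf_in t], reached at time 1, so it lies in [C]. *)
have LC p : path p \in C.
  case: p => y u; apply/mem_set.
  apply: (@connected_component_max _ _ ((fun v => path (y, v)) @` setT)) => //.
  - by exists 1 => //; rewrite /path L1E.
  - apply: connected_continuous_connected.
      by apply/connected_intervalP.
    apply: continuous_subspaceT => v.
    apply: (@continuous_comp _ _ _ (fun v : R => (y, v)) path); last exact: cpath.
    apply: (@cvg_pair _ _ _ _ (nbhs y) (nbhs v)); first exact: cst_continuous.
    exact: cvg_id.
have Cx : conf_in t \in C.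
  by apply/mem_set; exact: connected_component_refl.
exists (exist (fun z => z \in C) _ Cx), (fun p => exist (fun z => z \in C) _ (LC p)).
split.
- by apply: continuous_subspaceT; exact: set_type_continuous.
- by move=> y; apply/val_inj; exact: L0E.
- by move=> y; apply/val_inj; rewrite /= /path L1E.
Qed.
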